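(* Let $N$ be a non-negative integer and let $\alpha,\beta$ be real parameters. For the polynomials $P_n$ and the rational functions $V_n$ given by $$P_n(x)={}_3F_2\left({-n,\,-x,\,\alpha+1 \atop -N,\,1-\beta-n};1\right),\qquad V_n(x)={}_3F_2\left({-n,\,-x,\,-\alpha-N \atop -N,\,1+\beta-x};1\right),$$ the normalization factor $h_n$ in the biorthogonality relation $$\sum_{x=0}^N w_x P_n(x)V_m(x)=h_n\,\delta_{nm}$$ is given by $$h_n=\frac{n!\,(1+\alpha+\beta)_n}{(-N)_n(\beta)_n}.$$
   Context: Here $n,m=0,1,\dots,N$, ${}_3F_2$ is the standard hypergeometric function, $(a)_0=1$, $(a)_k=a(a+1)\cdots(a+k-1)$ is the Pochhammer symbol, and $\delta_{nm}$ is the Kronecker delta. The weight function on the grid $x=0,1,\dots,N$ is $$w_x=\frac{(-\alpha-\beta-N)_N}{(-\alpha-N)_N}\,\frac{(-N)_x(-\beta)_x}{x!\,(-\alpha-\beta-N)_x}.$$ *)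

(* Defs.v *)
From HB Require Import structures.
From mathcomp Require Import all_boot all_order all_algebra.
From mathcomp Require Import all_classical all_reals all_analysis.

Set Implicit Arguments.
Unset Strict Implicit.
Unset Printing Implicit Defensive.

Import Order.TTheory GRing.Theory Num.Theory.
Import numFieldNormedType.Exports.

Local Open Scope ring_scope.

Definition pochhammer {R : realType} (a : R) (k : nat) : R :=
  \prod_(i < k) (a + i%:R).

(* With an upper parameter - n (n natural), the series terminates: the terms of
   index k > n have a vanishing numerator.  This also covers a lower parameter
   - N with n <= N, whose Pochhammer symbol vanishes only for k > N: such terms
   are 0 / 0 = 0, in accordance with the usual convention. *)
Definition hyp3F2_coeff {R : realType} (a1 a2 a3 b1 b2 z : R) (k : nat) : R :=
  (pochhammer a1 k * pochhammer a2 k * pochhammer a3 k)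
    / (pochhammer b1 k * pochhammer b2 k) * (z ^+ k / k`!%:R).

Definition hyp3F2 {R : realType} (a1 a2 a3 b1 b2 z : R) : R :=
  limn (series (hyp3F2_coeff a1 a2 a3 b1 b2 z)).

Section Family.
Variables (R : realType) (N : nat) (alpha beta : R).

(* The parameters for which no denominator vanishes in the weight, in the
   functions P_n and V_n on the grid 0, ..., N, and in h_n, for all n <= N:
   alpha and alpha + beta are not in {-1, ..., -N}, and beta is not in
   {-(N-1), ..., N-1}. *)
Definition admissible : Prop :=
  forall i : nat, (i < N)%N ->
    [/\ alpha + i.+1%:R != 0, alpha + beta + i.+1%:R != 0,
        beta + i%:R != 0 & beta - i%:R != 0].

Definition weight (x : nat) : R :=
  pochhammer (- alpha - beta - N%:R) N / pochhammer (- alpha - N%:R) N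
  * (pochhammer (- N%:R) x * pochhammer (- beta) x
     / (x`!%:R * pochhammer (- alpha - beta - N%:R) x)).

Definition P (n : nat) (x : R) : R :=
  hyp3F2 (- n%:R) (- x) (alpha + 1) (- N%:R) (1 - beta - n%:R) 1.

Definition V (n : nat) (x : R) : R :=
  hyp3F2 (- n%:R) (- x) (- alpha - N%:R) (- N%:R) (1 + beta - x) 1.

Definition norm_factor (n : nat) : R :=
  n`!%:R * pochhammer (1 + alpha + beta) n
  / (pochhammer (- N%:R) n * pochhammer beta n).

End Family.

(* Main.v *)
(** Everything follows from the Chu-Vandermonde sum.  Expanding
    [C(x, k) / C(N, k)] over the [C(N - x, j) / C(N, j)] turns [P_n] into a
    series in [C(N - x, j)], while [w_x V_m(x)] is a combination over [k] of the
    measures [C(N - k, N - x) (-beta)_(x-k) (alpha+beta+1)_(N-x)].  The moments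
    of the k-th measure against [C(N - x, j)] are again Chu-Vandermonde sums,
    and the Pochhammer symbols depending on [j] cancel, so that the pairing of
    the k-th measure with [P_n] is a multiple of [C(k, n)].  What remains is the
    alternating sum of [C(m, k) C(k, n)], which vanishes unless [m = n]. *)
Require Import Defs.
From HB Require Import structures.
From mathcomp Require Import all_boot all_order all_algebra.
From mathcomp Require Import all_classical all_reals all_analysis.
From mathcomp Require Import ring zify.
Import Order.TTheory GRing.Theory Num.Theory.
Import numFieldNormedType.Exports.
Local Open Scope ring_scope.

(** * Pochhammer symbols *)

Lemma pochhammer0 (R : realType) (a : R) : pochhammer a 0 = 1.
Proof. by rewrite /pochhammer big_ord0. Qed.

Lemma pochhammerSr (R : realType) (a : R) k :
  pochhammer a k.+1 = pochhammer a k * (a + k%:R).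
Proof. by rewrite /pochhammer big_ord_recr. Qed.

Lemma pochhammerD (R : realType) (a : R) k l :
  pochhammer a (k + l) = pochhammer a k * pochhammer (a + k%:R) l.
Proof.
elim: l => [|l IHl]; first by rewrite addn0 pochhammer0 mulr1.
by rewrite addnS !pochhammerSr IHl natrD addrA mulrA.
Qed.

Lemma pochhammerSl (R : realType) (a : R) k :
  pochhammer a k.+1 = a * pochhammer (a + 1) k.
Proof. by rewrite -add1n pochhammerD pochhammerSr pochhammer0 addr0 mul1r. Qed.

Lemma pochhammer_split (R : realType) (a : R) j n : (j <= n)%N ->
  pochhammer a n = pochhammer a j * pochhammer (a + j%:R) (n - j).
Proof. by move=> le_jn; rewrite -pochhammerD subnKC. Qed.

(** Up to sign, the factors on the left are those of [pochhammer a k] in reverse order. This turns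
    lower parameters such as [1 - beta - n%:R] into shifts of [beta]. *)
Lemma pochhammer_reflect (R : realType) (a : R) k :
  pochhammer (1 - a - k%:R) k = (-1) ^+ k * pochhammer a k.
Proof.
elim: k => [|k IHk]; first by rewrite !pochhammer0 mulr1.
rewrite pochhammerSl pochhammerSr exprS -natr1.
have -> : 1 - a - (k%:R + 1) + 1 = 1 - a - k%:R by ring.
by rewrite IHk; ring.
Qed.

Lemma pochhammer_opp_nat (R : realType) n k :
  pochhammer (- n%:R : R) k = (-1) ^+ k * (k`! * 'C(n, k))%:R.
Proof.
rewrite mulnC bin_ffact.
elim: k => [|k IHk]; first by rewrite pochhammer0 ffactn0 mulr1.
rewrite pochhammerSr IHk ffactnSr natrM exprS.
have [le_kn|lt_nk] := leqP k n; first by rewrite natrB //; ring.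
by rewrite ffact_small //; ring.
Qed.

Lemma pochhammer_neq0 (R : realType) (a : R) n :
  (forall i, (i < n)%N -> a + i%:R != 0) -> pochhammer a n != 0.
Proof. by move=> a_neq0; apply/prodf_neq0 => i _; apply: a_neq0. Qed.

(** * Chu-Vandermonde and binomial sums *)

Lemma chu_vandermonde (R : realType) (a b : R) M :
  \sum_(i < M.+1) 'C(M, i)%:R * pochhammer a i * pochhammer b (M - i)
    = pochhammer (a + b) M.
Proof.
elim: M a b => [|M IHM] a b.
  by rewrite big_ord_recl big_ord0 !pochhammer0 bin0 !mulr1 addr0.
(* The factor [a + b] is split to match the two halves of Pascal's rule; the induction hypothesis
   serves at [(a, b + 1)] and at [(a + 1, b)]. *)
have -> : pochhammer (a + b) M.+1
    = b * pochhammer (a + (b + 1)) M + a * pochhammer (a + 1 + b) M.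
  rewrite pochhammerSl (_ : a + 1 + b = a + b + 1); last by ring.
  by rewrite (_ : a + (b + 1) = a + b + 1); ring.
rewrite -!IHM big_ord_recl bin0 pochhammer0 subn0 pochhammerSl !mulr1 mul1r.
under eq_bigr => i _ do
  rewrite lift0 binS natrD subSS pochhammerSl !mulrDl.
rewrite big_split /= addrA; congr (_ + _).
  rewrite big_ord_recr /= bin_small // !mul0r addr0.
  rewrite mulr_sumr [in RHS]big_ord_recl bin0 pochhammer0 !mul1r subn0.
  congr (_ + _); apply: eq_bigr => i _.
  by rewrite lift0 /= -(subnSK (ltn_ord i)) !pochhammerSl; ring.
by rewrite mulr_sumr; apply: eq_bigr => i _; ring.
Qed.

Lemma sum_bin_widen (R : realType) M K (F : nat -> R) : (M <= K)%N ->
  \sum_(i < K.+1) 'C(M, i)%:R * F i = \sum_(i < M.+1) 'C(M, i)%:R * F i.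
Proof.
move=> le_MK; rewrite [RHS](big_ord_widen K.+1 (fun i => 'C(M, i)%:R * F i)) //.
rewrite [RHS]big_mkcond; apply: eq_bigr => i _.
by rewrite ltnS; case: leqP => // /bin_small ->; rewrite mul0r.
Qed.

Lemma bin_trinomial n k j : (j <= k)%N ->
  ('C(n, k) * 'C(k, j) = 'C(n, j) * 'C(n - j, k - j))%N.
Proof.
move=> le_jk; have [le_kn|lt_nk] := leqP k n; last first.
  rewrite bin_small // mul0n; have [le_jn|lt_nj] := leqP j n.
    by rewrite (@bin_small (n - j)) ?muln0 // ltn_sub2rE.
  by rewrite bin_small.
have le_jn := leq_trans le_jk le_kn.
(* Multiplied by this product, both sides become n!. *)
have f_gt0 : (0 < j`! * (k - j)`! * (n - k)`!)%N by rewrite !muln_gt0 !fact_gt0.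
apply/eqP; rewrite -(eqn_pmul2r f_gt0); apply/eqP.
have Enk := bin_fact le_kn; have Ekj := bin_fact le_jk.
have Enj := bin_fact le_jn.
have := bin_fact (leq_sub2r j le_kn); rewrite subnBA // subnK // => Enjkj.
transitivity n`!.
  by rewrite -Enk -Ekj; nia.
by rewrite -Enj -Enjkj; nia.
Qed.

Lemma sum_bin_bin (R : realType) M j (F : nat -> R) : (j <= M)%N ->
  \sum_(i < M.+1) 'C(M, i)%:R * ('C(i, j)%:R * F i)
    = 'C(M, j)%:R * \sum_(i < (M - j).+1) 'C(M - j, i)%:R * F (j + i)%N.
Proof.
move=> le_jM.
rewrite -(big_mkord xpredT (fun i => 'C(M, i)%:R * ('C(i, j)%:R * F i))).
rewrite (@big_cat_nat _ _ _ j) //=; last exact: leqW.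
rewrite big_nat_cond big1 ?add0r => [|i /andP[/andP[_ lt_ij] _]]; last first.
  by rewrite [in 'C(i, j)]bin_small // mul0r mulr0.
rewrite -{1}[j]add0n big_addn subSn // big_mkord mulr_sumr.
apply: eq_bigr => i _; rewrite addnC !mulrA -!natrM.
by rewrite bin_trinomial ?leq_addr // addKn.
Qed.

(** Factorial moments of the Chu-Vandermonde sum: trinomial revision shifts the index by [j],
    [pochhammer a j] factors out, and a Chu-Vandermonde sum with parameters [a + j%:R] and [b]
    remains. *)
Lemma chu_vandermonde_bin (R : realType) (a b : R) M j :
  \sum_(i < M.+1) 'C(M, i)%:R
      * ('C(i, j)%:R * (pochhammer a i * pochhammer b (M - i)))
    = 'C(M, j)%:R * (pochhammer a j * pochhammer (a + b + j%:R) (M - j)).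
Proof.
have [le_jM|lt_Mj] := leqP j M; last first.
  rewrite bin_small // mul0r big1 // => i _.
  by rewrite [in 'C(i, j)]bin_small ?mul0r ?mulr0 //; have := ltn_ord i; lia.
rewrite (sum_bin_bin _ _ _ (fun i => pochhammer a i * pochhammer b (M - i))) //.
congr (_ * _).
rewrite addrAC -chu_vandermonde mulr_sumr; apply: eq_bigr => i _.
by rewrite pochhammerD subnDA; ring.
Qed.

Lemma sum_bin_sign (R : realType) m n :
  \sum_(k < m.+1) 'C(m, k)%:R * ('C(k, n)%:R * (-1) ^+ k)
    = (-1) ^+ n * (n == m)%:R :> R.
Proof.
have [le_nm|lt_mn] := leqP n m; last first.
  rewrite gtn_eqF // mulr0 big1 // => i _.
  by rewrite [in 'C(i, n)]bin_small ?mul0r ?mulr0 //; have := ltn_ord i; lia.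
rewrite (sum_bin_bin _ _ _ (fun k => (-1) ^+ k)) //.
under eq_bigr => i _ do rewrite exprD mulrCA.
rewrite -mulr_sumr.
have -> : \sum_(i < (m - n).+1) 'C(m - n, i)%:R * (-1) ^+ i
    = (n == m)%:R :> R.
  (* The sum is the expansion of (1 - 1)^(m - n). *)
  have := @exprDn R 1 (-1) (m - n); rewrite subrr expr0n => E.
  transitivity (((m - n)%N == 0%N)%:R : R).
    by rewrite E; apply: eq_bigr => i _; rewrite expr1n mul1r mulr_natl.
  by rewrite subn_eq0 eqn_leq le_nm.
by have [->|_] := eqVneq n m; rewrite ?binn ?mulr0 // mul1r.
Qed.

Lemma bin_natr_neq0 (R : realType) n k : (k <= n)%N -> 'C(n, k)%:R != 0 :> R.
Proof. by move=> le_kn; rewrite pnatr_eq0 -lt0n bin_gt0. Qed.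

Lemma fact_natr_neq0 (R : realType) n : n`!%:R != 0 :> R.
Proof. by rewrite pnatr_eq0 -lt0n fact_gt0. Qed.

(** Once [k! * 'C(N, k)] is cleared, this is Chu-Vandermonde with parameters -(N - x) and 1 + N - k.
    They add up to 1 + x - k, whose Pochhammer symbol of length [k] is k! C(x, k). *)
Lemma sum_bin_ratio (R : realType) N k x : (k <= N)%N -> (x <= N)%N ->
  \sum_(j < k.+1) 'C(k, j)%:R * ((-1) ^+ j * ('C(N - x, j)%:R / 'C(N, j)%:R))
    = 'C(x, k)%:R / 'C(N, k)%:R :> R.
Proof.
move=> le_kN le_xN.
apply: (mulIf (mulf_neq0 (@fact_natr_neq0 R k) (@bin_natr_neq0 R _ _ le_kN))).
transitivity ((k`! * 'C(x, k))%:R : R); last first.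
  by rewrite natrM; field; apply: bin_natr_neq0.
have := @chu_vandermonde R (- (N - x)%:R) (1 + N%:R - k%:R) k.
have -> : - (N - x)%:R + (1 + N%:R - k%:R) = 1 - (- x%:R) - k%:R :> R.
  by rewrite natrB //; ring.
rewrite pochhammer_reflect pochhammer_opp_nat mulrA -exprMn mulrNN mulr1 expr1n.
rewrite mul1r => <-; rewrite mulr_suml; apply: eq_bigr => j _.
have le_jk : (j <= k)%N by rewrite -ltnS.
have le_jN := leq_trans le_jk le_kN.
rewrite pochhammer_opp_nat.
have -> : 1 + N%:R - k%:R = 1 - (- (N - j)%:R) - (k - j)%:R :> R.
  by rewrite !natrB //; ring.
rewrite pochhammer_reflect pochhammer_opp_nat mulrA.
rewrite [(-1) ^+ (k - j) * _]mulrA -exprMn mulrNN mulr1 expr1n mul1r.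
have E : k`!%:R * 'C(N, k)%:R * 'C(k, j)%:R
    = k`!%:R * 'C(N, j)%:R * 'C(N - j, k - j)%:R :> R.
  by rewrite -!natrM -!mulnA bin_trinomial.
have Ek : (k`!)%:R = 'C(k, j)%:R * (j`!%:R * (k - j)`!%:R) :> R.
  by rewrite -!natrM bin_fact.
rewrite !natrM.
transitivity ((-1) ^+ j * ('C(N - x, j)%:R / 'C(N, j)%:R)
   * (k`!%:R * 'C(N, k)%:R * 'C(k, j)%:R : R)); first by ring.
by rewrite E Ek; field; apply: bin_natr_neq0.
Qed.

(** * Terminating series on the grid *)

Lemma hyp3F2_terminating (R : realType) n (a2 a3 b1 b2 z : R) :
  hyp3F2 (- n%:R) a2 a3 b1 b2 z
    = \sum_(k < n.+1) hyp3F2_coeff (- n%:R) a2 a3 b1 b2 z k.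
Proof.
(* The partial sums are constant from [n.+1] on: the numerators beyond are 0, and so are the terms
   even over a zero denominator, whatever [b1] and [b2] are. *)
apply: lim_near_cst => //; exists n.+1 => // M /= lt_nM.
rewrite /series /= (@big_cat_nat _ _ _ n.+1) //= big_mkord.
rewrite [X in _ + X]big_nat_cond [X in _ + X]big1 ?addr0 //.
move=> k /andP[/andP[lt_nk _] _].
by rewrite /hyp3F2_coeff pochhammer_opp_nat bin_small // muln0 mulr0 !mul0r.
Qed.

Lemma P_grid (R : realType) N (alpha beta : R) n x :
  (n <= N)%N -> (x <= N)%N -> pochhammer beta n != 0 ->
  P N alpha beta n x%:R
    = (\sum_(k < n.+1) 'C(n, k)%:R * ('C(x, k)%:R / 'C(N, k)%:R
         * (pochhammer (alpha + 1) k * pochhammer beta (n - k))))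
      / pochhammer beta n.
Proof.
move=> le_nN le_xN beta_n; rewrite /P hyp3F2_terminating mulr_suml.
apply: eq_bigr => k _; have le_kn : (k <= n)%N by rewrite -ltnS.
have beta_split := @pochhammer_split R beta _ _ (leq_subr k n).
rewrite subKn // in beta_split.
move: beta_n; rewrite /hyp3F2_coeff beta_split mulf_eq0 negb_or.
case/andP=> beta_nk beta_k.
rewrite !pochhammer_opp_nat expr1n.
have -> : 1 - beta - n%:R = 1 - (beta + (n - k)%:R) - k%:R.
  by rewrite natrB //; ring.
rewrite pochhammer_reflect !natrM.
have s_neq0 : (-1) ^+ k != 0 :> R by rewrite signr_eq0.
move: ((-1) ^+ k) s_neq0 => s s_neq0; field.
by rewrite beta_k beta_nk s_neq0 fact_natr_neq0 bin_natr_neq0 // (leq_trans le_kn).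
Qed.

Lemma P_grid_rev (R : realType) N (alpha beta : R) n x :
  (n <= N)%N -> (x <= N)%N -> pochhammer beta n != 0 ->
  P N alpha beta n x%:R
    = (\sum_(j < n.+1) 'C(n, j)%:R
         * ((-1) ^+ j * ('C(N - x, j)%:R / 'C(N, j)%:R)
            * (pochhammer (alpha + 1) j
               * pochhammer (alpha + 1 + beta + j%:R) (n - j))))
      / pochhammer beta n.
Proof.
move=> le_nN le_xN beta_n; rewrite P_grid //; congr (_ / _).
pose G j : R := (-1) ^+ j * ('C(N - x, j)%:R / 'C(N, j)%:R).
pose H k := pochhammer (alpha + 1) k * pochhammer beta (n - k).
transitivity (\sum_(k < n.+1) \sum_(j < n.+1)
    G j * ('C(n, k)%:R * ('C(k, j)%:R * H k))).
  apply: eq_bigr => k _; have le_kn : (k <= n)%N by rewrite -ltnS.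
  rewrite -sum_bin_ratio // ?(leq_trans le_kn) //.
  (* The range of [j] is made independent of [k], so that the two sums can be exchanged. *)
  rewrite -(@sum_bin_widen _ _ n G) // mulr_suml mulr_sumr.
  by apply: eq_bigr => j _; rewrite /H; ring.
rewrite exchange_big; apply: eq_bigr => j _.
by rewrite -mulr_sumr chu_vandermonde_bin /G; ring.
Qed.

(** By reflection, the denominator (1 + beta - x)_k of [V] is, up to sign, the last [k] factors of
    (-beta)_x in the weight, so the product keeps only (-beta)_(x-k). *)
Lemma weight_V_grid (R : realType) N (alpha beta : R) m x :
  (m <= N)%N -> (x <= N)%N -> pochhammer (alpha + 1) N != 0 ->
  pochhammer (alpha + 1 + beta) N != 0 -> pochhammer (- beta) x != 0 ->
  weight N alpha beta x * V N alpha beta m x%:R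
    = (\sum_(k < m.+1) 'C(m, k)%:R * (pochhammer (- alpha - N%:R) k
         * ('C(N - k, N - x)%:R * (pochhammer (alpha + 1 + beta) (N - x)
                                   * pochhammer (- beta) (x - k)))))
      / pochhammer (alpha + 1) N.
Proof.
move=> le_mN le_xN alpha_N gamma_N beta_x.
rewrite /V hyp3F2_terminating mulr_sumr mulr_suml; apply: eq_bigr => k _.
have le_kN : (k <= N)%N by apply: leq_trans le_mN; rewrite -ltnS.
(* For [x < k] both sides vanish, through (-x)_k and through ['C(N - k, N - x)]. *)
have [le_kx|lt_xk] := leqP k x; last first.
  rewrite /hyp3F2_coeff (@pochhammer_opp_nat _ x) (bin_small lt_xk).
  rewrite (@bin_small (N - k)); last by lia.
  by rewrite muln0 !(mulr0, mul0r).
have beta_split := @pochhammer_split R (- beta) _ _ (leq_subr k x).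
rewrite subKn // in beta_split.
have gamma_split :=
  @pochhammer_split R (alpha + 1 + beta) _ _ (leq_subr x N).
rewrite subKn // in gamma_split.
move: beta_x gamma_N; rewrite /weight /hyp3F2_coeff beta_split.
have -> : - alpha - beta - N%:R
    = 1 - (alpha + 1 + beta + (N - x)%:R) - x%:R by rewrite natrB //; ring.
rewrite (pochhammer_reflect _ _ x).
have -> : 1 - (alpha + 1 + beta + (N - x)%:R) - x%:R
    = 1 - (alpha + 1 + beta) - N%:R by rewrite natrB //; ring.
rewrite pochhammer_reflect gamma_split !mulf_eq0 !negb_or.
case/andP=> beta_xk beta_k /andP[gamma_Nx gamma_x].
have -> : 1 + beta - x%:R = 1 - (- beta + (x - k)%:R) - k%:R.
  by rewrite natrB //; ring.
have {1}-> : - alpha - N%:R = 1 - (alpha + 1) - N%:R by ring.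
rewrite !pochhammer_reflect !pochhammer_opp_nat expr1n !natrM.
have -> : 'C(N - k, N - x)%:R = 'C(N, x)%:R * 'C(x, k)%:R / 'C(N, k)%:R :> R.
  rewrite -natrM bin_trinomial // natrM mulrAC mulfV ?bin_natr_neq0 // mul1r.
  by rewrite -bin_sub; [congr (_%:R); congr 'C(_, _) | ]; lia.
have s_neq0 i : (-1) ^+ i != 0 :> R by rewrite signr_eq0.
move: ((-1) ^+ k) ((-1) ^+ x) ((-1) ^+ N) (s_neq0 k) (s_neq0 x) (s_neq0 N).
move=> sk sx sN sk_neq0 sx_neq0 sN_neq0; field.
by rewrite alpha_N beta_k gamma_x sk_neq0 sx_neq0 sN_neq0 !fact_natr_neq0
  bin_natr_neq0.
Qed.

(** * Pairing the measures with [P] *)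

Theorem proposition6p1 (R : realType) (N : nat) (alpha beta : R)
    (hadm : admissible N alpha beta) (n m : nat)
    (hn : (n <= N)%N) (hm : (m <= N)%N) :
  \sum_(x < N.+1) weight N alpha beta x
                  * P N alpha beta n x%:R * V N alpha beta m x%:R
    = norm_factor N alpha beta n * (n == m)%:R.
Proof.
have alpha_N : pochhammer (alpha + 1) N != 0.
  apply: pochhammer_neq0 => i /hadm[+ _ _ _].
  by rewrite -natr1 (addrC i%:R) addrA.
set gamma := alpha + 1 + beta.
have gamma_N : pochhammer gamma N != 0.
  apply: pochhammer_neq0 => i /hadm[_ + _ _].
  by rewrite -natr1 /gamma (addrC i%:R) addrA (addrAC alpha 1).
have beta_n : pochhammer beta n != 0.
  by apply: pochhammer_neq0 => i lt_in; have [] := hadm i (leq_trans lt_in hn).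
have beta_x x : (x <= N)%N -> pochhammer (- beta) x != 0.
  move=> le_xN; apply: pochhammer_neq0 => i lt_ix.
  have [_ _ _] := hadm i (leq_trans lt_ix le_xN).
  by rewrite -oppr_eq0 opprB addrC.
(* Here [p] carries the coefficients of [V], [r] and [c] those of the reversed form of [P], and
   [d k z] the k-th measure at [z = N - x]; [q] gathers the denominators. *)
pose p k := pochhammer (- alpha - N%:R) k.
pose c j := pochhammer (alpha + 1) j * pochhammer (gamma + j%:R) (n - j).
pose d k z := pochhammer gamma z * pochhammer (- beta) (N - k - z).
pose q := (pochhammer (alpha + 1) N * pochhammer beta n)^-1.
pose r j : R := (-1) ^+ j / 'C(N, j)%:R.
transitivity (q * \sum_(z < N.+1) \sum_(k < m.+1) \sum_(j < n.+1)
    'C(m, k)%:R * p k * ('C(n, j)%:R * (r j * c j))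
    * ('C(N - k, z)%:R * ('C(z, j)%:R * d k z))).
  rewrite (reindex_inj rev_ord_inj) mulr_sumr; apply: eq_bigr => z _.
  have le_zN : (z <= N)%N by rewrite -ltnS.
  rewrite /= subSS mulrAC weight_V_grid ?leq_subr ?beta_x ?leq_subr //.
  rewrite P_grid_rev ?leq_subr // subKn // -/gamma.
  rewrite mulf_div -[RHS]mulrC /q; congr (_ / _).
  rewrite mulr_suml; apply: eq_bigr => k _.
  rewrite mulr_sumr; apply: eq_bigr => j _.
  by rewrite /p /r /c /d subnAC; ring.
(* Since [gamma - beta = alpha + 1], the moment contains (gamma)_j and (alpha + 1 + j)_(N-k-j). The
   two factors of [c j] complete them to symbols free of [j]. *)
have inner k j : (k <= N)%N -> (j <= n)%N ->
    c j * (\sum_(z < N.+1) 'C(N - k, z)%:R * ('C(z, j)%:R * d k z))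
    = 'C(N - k, j)%:R * (pochhammer gamma n * pochhammer (alpha + 1) (N - k)).
  move=> le_kN le_jn.
  rewrite (@sum_bin_widen _ _ N (fun z => 'C(z, j)%:R * d k z)) ?leq_subr //.
  rewrite chu_vandermonde_bin.
  have [le_jNk|lt_Nkj] := leqP j (N - k); last first.
    by rewrite bin_small // !mul0r mulr0.
  rewrite (pochhammer_split _ gamma _ _ le_jn).
  rewrite (pochhammer_split _ (alpha + 1) _ _ le_jNk).
  by rewrite /c /gamma addrK; ring.
transitivity (q * \sum_(k < m.+1) pochhammer gamma n / 'C(N, n)%:R
    * pochhammer (alpha + 1) N * ('C(m, k)%:R * ('C(k, n)%:R * (-1) ^+ k))).
  congr (_ * _); rewrite exchange_big; apply: eq_bigr => k _.
  have le_kN : (k <= N)%N by apply: leq_trans hm; rewrite -ltnS.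
  rewrite exchange_big /=.
  transitivity ('C(m, k)%:R * p k
      * (pochhammer gamma n * pochhammer (alpha + 1) (N - k))
      * \sum_(j < n.+1) 'C(n, j)%:R
          * ((-1) ^+ j * ('C(N - k, j)%:R / 'C(N, j)%:R))).
    rewrite mulr_sumr; apply: eq_bigr => j _.
    rewrite -mulr_sumr -2!mulrA.
    rewrite (_ : _ * (r j * c j) * _ = 'C(n, j)%:R * r j
      * (c j * \sum_(z < N.+1) 'C(N - k, z)%:R * ('C(z, j)%:R * d k z))).
      by rewrite inner // ?/r; [ring | rewrite -ltnS].
    by ring.
  (* The sum over [j] is taken at the grid point [k], giving C(k, n) / C(N, n). *)
  rewrite sum_bin_ratio //.
  have alpha_split := @pochhammer_split R (alpha + 1) _ _ (leq_subr k N).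
  rewrite subKn // in alpha_split.
  (* Reflected, [p k] supplies the missing last [k] factors of (alpha + 1)_N, together with the sign
     of the final alternating sum. *)
  have -> : p k = (-1) ^+ k * pochhammer (alpha + 1 + (N - k)%:R) k.
    by rewrite -pochhammer_reflect /p; congr pochhammer; rewrite natrB //; ring.
  by rewrite alpha_split; ring.
(* The remaining sign and ['C(N, n)] are absorbed by (-N)_n = (-1)^n n! C(N, n). *)
rewrite -mulr_sumr sum_bin_sign /q /norm_factor pochhammer_opp_nat natrM.
rewrite (_ : 1 + alpha + beta = gamma); last by rewrite /gamma (addrC 1).
case: eqVneq => _; last by rewrite !mulr0.
rewrite !mulr1 !invfM invr_sign; field.
by rewrite alpha_N beta_n fact_natr_neq0 bin_natr_neq0.
Qed.
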